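(* For every $s\in\mathbb{N}$ there exists a graph $G$ with queue number at most $3$ and stack number at least $s$.
   Context: Graphs are finite, simple and undirected. Let $L$ be a linear order on $V(G)$. Two edges with no common endpoint, written uniquely as $e_1=(a,b)$, $e_2=(c,d)$ with $a<b$ and $c<d$ in $L$, are said to nest if $a<c<d<b$ or $c<a<b<d$, and to cross if $a<c<b<d$ or $c<a<d<b$ (all comparisons with respect to $L$). Edges sharing an endpoint neither nest nor cross. A $k$-queue layout (resp. $k$-stack layout) of $G$ is a pair $(L,\phi)$ where $L$ is a total order on $V(G)$ and $\phi$ is a colouring of $E(G)$ with $k$ colours (not necessarily proper) such that no two edges of the same colour nest (resp. cross) with respect to $L$. The queue number (resp. stack number) of $G$ is the smallest integer $k$ such that $G$ admits a $k$-queue layout (resp. $k$-stack layout). *)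

(* Defs.v *)
From mathcomp Require Import all_boot.

Set Implicit Arguments.
Unset Strict Implicit.
Unset Printing Implicit Defensive.

Record sgraph := SGraph {
  vertex :> finType;
  adj : rel vertex;
  adj_sym : symmetric adj;
  adj_irr : irreflexive adj
}.

Definition edges (G : sgraph) : {set {set G}} :=
  [set [set p.1; p.2] | p : G * G & adj p.1 p.2].

Definition edge (G : sgraph) := {e : {set G} | e \in edges G}.

(* A relation on a finite type is encoded as its set of pairs, so that the
   layouts of a graph form a finite type and their existence is decidable.
   [ord_le L] is the non-strict order, [ord_lt L] its strict part. *)
Section Orders.
Variable T : finType.
Implicit Type L : {set T * T}.

Definition ord_le L : rel T := fun a b => (a, b) \in L.
Definition ord_lt L : rel T := fun a b => (a != b) && ord_le L a b.

Definition total_order L : bool :=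
  [&& [forall a, ord_le L a a],
      [forall a, forall b, ord_le L a b && ord_le L b a ==> (a == b)],
      [forall b, forall a, forall c,
         ord_le L a b ==> ord_le L b c ==> ord_le L a c]
    & [forall a, forall b, ord_le L a b || ord_le L b a]].

Lemma total_orderP L :
  reflect [/\ reflexive (ord_le L), antisymmetric (ord_le L),
              transitive (ord_le L) & total (ord_le L)]
          (total_order L).
Proof.
apply: (iffP and4P) => [[/forallP r /forallP a /forallP t /forallP o]|[r a t o]].
  split=> [x|x y xy|y x z xy yz|x y]; first exact: r.
  - by have /forallP/(_ y) := a x; rewrite xy => /eqP.
  - have /forallP/(_ x)/forallP/(_ z) := t y.
    by rewrite xy yz.
  - by have /forallP/(_ y) := o x.
split; apply/forallP=> x; rewrite ?r //; apply/forallP=> y; rewrite ?o //.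
  by apply/implyP=> /a ->.
by apply/forallP=> z; apply/implyP=> xy; apply/implyP; apply: t xy.
Qed.

(* [oriented L e a b]: e is the pair written (a,b) with a < b. *)
Definition oriented L (e : {set T}) (a b : T) : bool :=
  (e == [set a; b]) && ord_lt L a b.

(* In both definitions the strict chains force the four endpoints to be
   distinct, so edges sharing an endpoint neither nest nor cross. *)
Definition nest L (e1 e2 : {set T}) : bool :=
  [exists a, exists b, exists c, exists d,
    [&& oriented L e1 a b, oriented L e2 c d
      & [&& ord_lt L a c, ord_lt L c d & ord_lt L d b]
        || [&& ord_lt L c a, ord_lt L a b & ord_lt L b d]]].

Definition cross L (e1 e2 : {set T}) : bool :=
  [exists a, exists b, exists c, exists d,
    [&& oriented L e1 a b, oriented L e2 c d
      & [&& ord_lt L a c, ord_lt L c b & ord_lt L b d]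
        || [&& ord_lt L c a, ord_lt L a d & ord_lt L d b]]].

End Orders.

Definition queue_layout (G : sgraph) (k : nat)
    (L : {set G * G}) (phi : {ffun edge G -> 'I_k}) : bool :=
  total_order L &&
  [forall e1 : edge G, forall e2 : edge G,
     (phi e1 == phi e2) ==> ~~ nest L (val e1) (val e2)].

Definition stack_layout (G : sgraph) (k : nat)
    (L : {set G * G}) (phi : {ffun edge G -> 'I_k}) : bool :=
  total_order L &&
  [forall e1 : edge G, forall e2 : edge G,
     (phi e1 == phi e2) ==> ~~ cross L (val e1) (val e2)].

Definition has_queue_layout (G : sgraph) (k : nat) : bool :=
  [exists L : {set G * G}, exists phi : {ffun edge G -> 'I_k},
     queue_layout L phi].

Definition has_stack_layout (G : sgraph) (k : nat) : bool :=
  [exists L : {set G * G}, exists phi : {ffun edge G -> 'I_k},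
     stack_layout L phi].


Lemma total_order_exists (T : finType) : exists L : {set T * T}, total_order L.
Proof.
exists [set p | enum_rank p.1 <= enum_rank p.2]; apply/total_orderP.
split=> [a|a b|b a c|a b]; rewrite /ord_le !inE ?leqnn //=.
- by rewrite -eqn_leq => /eqP/val_inj/enum_rank_inj.
- exact: leq_trans.
- exact: leq_total.
Qed.

Lemma ord_lt_asym (T : finType) (L : {set T * T}) a b :
  total_order L -> ord_lt L a b -> ord_lt L b a = false.
Proof.
case/total_orderP=> _ anti _ _ /andP[ab lab]; apply/negP=> /andP[_ lba].
by case/eqP: ab; apply: anti; rewrite lab lba.
Qed.

Lemma oriented_inj (T : finType) (L : {set T * T}) e a b c d :
  total_order L -> oriented L e a b -> oriented L e c d -> a = c /\ b = d.
Proof.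
move=> tL /andP[/eqP-> ab] /andP[/eqP E cd].
have : a \in [set c; d] by rewrite -E set21.
have : b \in [set c; d] by rewrite -E set22.
rewrite !inE => /orP[]/eqP hb /orP[]/eqP ha; subst a b => //.
- by move: ab; rewrite /ord_lt eqxx.
- by move: ab; rewrite (ord_lt_asym tL cd).
- by move: ab; rewrite /ord_lt eqxx.
Qed.

Lemma nest_irr (T : finType) (L : {set T * T}) e :
  total_order L -> ~~ nest L e e.
Proof.
move=> tL; apply/negP=> /existsP[a /existsP[b /existsP[c /existsP[d]]]].
case/and3P=> o1 o2; have [<- <-] := oriented_inj tL o1 o2.
by rewrite /ord_lt !eqxx.
Qed.

Lemma cross_irr (T : finType) (L : {set T * T}) e :
  total_order L -> ~~ cross L e e.
Proof.
move=> tL; apply/negP=> /existsP[a /existsP[b /existsP[c /existsP[d]]]].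
case/and3P=> o1 o2; have [<- <-] := oriented_inj tL o1 o2.
by rewrite /ord_lt !eqxx.
Qed.

Lemma ex_queue_layout (G : sgraph) : exists k, has_queue_layout G k.
Proof.
have [L tL] := total_order_exists G.
exists #|{: edge G}|; apply/existsP; exists L; apply/existsP.
exists (finfun enum_rank); rewrite /queue_layout tL.
apply/forallP=> e1; apply/forallP=> e2; apply/implyP; rewrite !ffunE.
by move/eqP/enum_rank_inj->; apply: nest_irr.
Qed.

Lemma ex_stack_layout (G : sgraph) : exists k, has_stack_layout G k.
Proof.
have [L tL] := total_order_exists G.
exists #|{: edge G}|; apply/existsP; exists L; apply/existsP.
exists (finfun enum_rank); rewrite /stack_layout tL.
apply/forallP=> e1; apply/forallP=> e2; apply/implyP; rewrite !ffunE.
by move/eqP/enum_rank_inj->; apply: cross_irr.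
Qed.


Definition queue_number (G : sgraph) : nat := ex_minn (ex_queue_layout G).
Definition stack_number (G : sgraph) : nat := ex_minn (ex_stack_layout G).

(* Main.v *)
Require Import Defs.
From mathcomp Require Import all_boot.
From mathcomp Require Import all_order all_algebra zify.

(** The graph has the integers 0..W^3 as vertices, and two of them are adjacent
when they differ by W, W+1, W^2, W^2+1, W^2+W or W^2+W+1.  In the usual order
of the integers, edges whose lengths differ by at most one never nest, so the
three pairs of consecutive lengths are three queues.  The point of these
lengths is that (x,y,z) |-> W^2(x+z) + W(x+y) + x turns the six steps x, y, z,
x-y, x-z, y+z into them: the graph contains a three-dimensional box in which
every unit square parallel to a coordinate plane has a diagonal.

Let a stack layout with k pages be given.  Cutting its vertex order at two
places t <= c gives a 3-colouring of the vertices by intervals.  Take two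
rainbow triangles without common vertex whose corresponding edges lie on the
same pages.  Two of the three colour classes then list the two triangles in the
same order, and the edges between these classes cross on one page; this is
impossible.  So in each coordinate direction at most (k+1)^3 parallel planes
contain a rainbow triangle ([few_rainbow_planes]).

On a plane without rainbow triangle, called good here, no closed walk winds
around the colour triangle, so the colouring lifts to an integer-valued function
that changes by at most one along edges.  Through one good plane y = b and the good planes
x = a and z = a', the colouring of the face y = 0 lifts to an integer function h
that is 1-Lipschitz along all good grid lines ([grid_lift_exists]).  Label the
pair (t,c) with the colour at a median of h.  The label avoids the colours
missing on the sides of the triangle 0 <= t <= c, so Sperner's lemma
([sperner_triangle]) yields three neighbouring pairs with three different
labels.  Neighbouring pairs have almost the same colouring, hence, up to
translation, the same h; distinct labels give it medians that differ by at least
two.  The points strictly between two such medians are few, yet they separate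
two sets of nearly half the points of the square grid, and this is impossible
in a large grid ([medians_close]). *)

Set Implicit Arguments.
Unset Strict Implicit.
Unset Printing Implicit Defensive.

Import Order.TTheory GRing.Theory Num.Theory.

(** * Winding of 3-colourings *)

(** The colours 0, 1, 2 are the corners of a triangle; [turn u v] is the signed
step from [u] to [v] along its boundary. *)
Definition turn (u v : nat) : int :=
  if v == u then 0%R else if v == u.+1 %% 3 then 1%R else (-1)%R.

(** The corners of a unit square come in the order (0,0), (1,0), (0,1), (1,1), so
the equation says that the colours have no winding around the square. *)
Definition flat (a b c d : nat) : Prop :=
  (turn a b + turn b d = turn a c + turn c d)%R.

(** Two of the three corners coincide in colour, so one step vanishes or two
steps cancel. *)
Lemma turn_triangle u v w : u < 3 -> v < 3 -> w < 3 ->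
  ~~ uniq [:: u; v; w] -> (turn u v + turn v w = turn u w)%R.
Proof.
by case: u v w => [|[|[|u]]] // [|[|[|v]]] // [|[|[|w]]].
Qed.

Lemma turn_le1 u v : (`|turn u v| <= 1)%R.
Proof. by rewrite /turn; case: ifP => // _; case: ifP. Qed.

Lemma turn_mod u v : u < 3 -> v < 3 -> exists q : int, (turn u v = v%:Z - u%:Z + 3 * q)%R.
Proof.
case: u v => [|[|[|u]]] // [|[|[|v]]] // _ _; rewrite /turn /=;
  (by exists 0%R) || (by exists 1%R) || (by exists (-1)%R).
Qed.

Lemma flat_diagonal a b c d : a < 3 -> b < 3 -> c < 3 -> d < 3 ->
  ~~ uniq [:: a; b; d] -> ~~ uniq [:: a; c; d] -> flat a b c d.
Proof. by move=> *; rewrite /flat !turn_triangle. Qed.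

Lemma flat_antidiagonal a b c d : a < 3 -> b < 3 -> c < 3 -> d < 3 ->
  ~~ uniq [:: a; b; c] -> ~~ uniq [:: b; c; d] -> flat a b c d.
Proof.
move=> a3 b3 c3 d3 abc bcd; have := turn_triangle a3 b3 c3 abc.
have := turn_triangle b3 c3 d3 bcd; rewrite /flat; lia.
Qed.

Definition winding (f : nat -> nat) (i n : nat) : int :=
  (\sum_(i <= j < n) turn (f j) (f j.+1))%R.

Lemma winding_nil f i : winding f i i = 0%R.
Proof. by rewrite /winding big_geq. Qed.

Lemma winding_recr f i n : i <= n ->
  winding f i n.+1 = (winding f i n + turn (f n) (f n.+1))%R.
Proof. by move=> ?; rewrite /winding big_nat_recr. Qed.

Lemma winding_recl f i n : i < n ->
  winding f i n = (turn (f i) (f i.+1) + winding f i.+1 n)%R.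
Proof. by move=> ?; rewrite /winding big_ltn. Qed.

Lemma winding_mod f i n : (forall j, f j < 3) -> i <= n ->
  exists q : int, (winding f i n = (f n)%:Z - (f i)%:Z + 3 * q)%R.
Proof.
move=> f3; elim: n => [|n IH] ilen.
  exists 0%R; have -> : i = 0 by lia.
  rewrite winding_nil; lia.
case: (leqP i n) => in_; last first.
  exists 0%R; have -> : i = n.+1 by lia.
  rewrite winding_nil; lia.
have [q Eq] := IH in_; have [q' Eq'] := turn_mod (f3 n) (f3 n.+1).
exists (q + q')%R; rewrite winding_recr // Eq Eq'; lia.
Qed.

(** Discrete Stokes formula: the ladder between the rows [u] and [v] is a stack
of flat squares, so both ways from [u i] to [v n] have the same winding. *)
Lemma winding_strip u v i n : i <= n ->
  (forall j, i <= j < n -> flat (u j) (v j) (u j.+1) (v j.+1)) ->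
  (turn (u i) (v i) + winding v i n = winding u i n + turn (u n) (v n))%R.
Proof.
elim: n => [|n IH] ilen fl.
  have -> : i = 0 by lia.
  rewrite !winding_nil; lia.
case: (leqP i n) => in_; last first.
  have -> : i = n.+1 by lia.
  rewrite !winding_nil; lia.
have := IH in_ (fun j Hj => fl j ltac:(lia)); have := fl n ltac:(lia).
rewrite /flat !winding_recr //; lia.
Qed.

Lemma winding_linear (w : nat -> int) f i n : i <= n ->
  (forall j, i <= j < n -> turn (f j) (f j.+1) = (w (f j.+1) - w (f j))%R) ->
  winding f i n = (w (f n) - w (f i))%R.
Proof.
move=> ilen H; rewrite /winding (eq_big_nat _ _ H).
by rewrite (telescope_sumr (fun j => w (f j))).
Qed.

(** Without rainbow cell the boundary of the large triangle would have winding
zero.  But each side misses one colour, so the winding along it is determined by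
the labels of the three corners, and the total is three steps in one direction. *)
Lemma sperner_triangle M (l : nat -> nat -> nat) :
  (forall t c, l t c < 3) ->
  (forall c, c <= M -> l 0 c != 0) ->
  (forall t, t <= M -> l t M != 2) ->
  (forall t, t <= M -> l t t != 1) ->
  exists t c, [/\ t <= c, c < M &
    uniq [:: l t c; l t c.+1; l t.+1 c.+1] \/
    t < c /\ uniq [:: l t c; l t.+1 c; l t.+1 c.+1]].
Proof.
move=> l3 l0 lM ld.
pose bad (p : 'I_M * 'I_M) := let t : nat := p.1 in let c : nat := p.2 in
  (t <= c) && (uniq [:: l t c; l t c.+1; l t.+1 c.+1] ||
    (t < c) && uniq [:: l t c; l t.+1 c; l t.+1 c.+1]).
case: (boolP [exists p, bad p]) => [/existsP[[t c] /andP[tc H]]|/existsPn nb].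
  exists t, c; split=> //.
  by case/orP: H => [H|/andP[tc2 H]]; [left | right].
have nb' t c (tM : t < M) (cM : c < M) : t <= c ->
    ~~ (uniq [:: l t c; l t c.+1; l t.+1 c.+1] ||
    (t < c) && uniq [:: l t c; l t.+1 c; l t.+1 c.+1]).
  by have := nb (Ordinal tM, Ordinal cM); rewrite negb_and => /orP[/negP|].
have up t c : t <= c -> c < M -> ~~ uniq [:: l t c; l t c.+1; l t.+1 c.+1].
  move=> tc cM; have := nb' t c (leq_ltn_trans tc cM) cM tc.
  by rewrite negb_or => /andP[].
have dn t c : t < c -> c < M -> ~~ uniq [:: l t c; l t.+1 c; l t.+1 c.+1].
  move=> tc cM; have := nb' t c (ltn_trans tc cM) cM (ltnW tc).
  by rewrite negb_or tc => /andP[].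
(* Sweep the triangle by the columns t = constant. *)
have col t : t < M ->
  (winding (l t) t M + turn (l t M) (l t.+1 M) =
   turn (l t t) (l t.+1 t.+1) + winding (l t.+1) t.+1 M)%R.
  move=> tM; rewrite winding_recl //.
  have := turn_triangle (l3 t t) (l3 t t.+1) (l3 t.+1 t.+1) (up t t (leqnn t) tM).
  have S : (turn (l t t.+1) (l t.+1 t.+1) + winding (l t.+1) t.+1 M =
      winding (l t) t.+1 M + turn (l t M) (l t.+1 M))%R.
    apply: winding_strip => // j /andP[tj jM].
    by apply: flat_diagonal; rewrite ?l3 ?dn ?up // ltnW.
  move: S; lia.
have tel t : t <= M ->
  (winding (l 0%N) 0 M + winding (fun i => l i M) 0 t =
   winding (fun i => l i i) 0 t + winding (l t) t M)%R.
  elim: t => [|t IH] tM; first by rewrite !winding_nil; lia.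
  have := IH (ltnW tM); have := col t tM; rewrite !winding_recr //; lia.
have := tel M (leqnn M); rewrite winding_nil.
(* Where a colour is missing, [turn] is the difference of a function of the label. *)
rewrite (@winding_linear Posz (l 0)) //; last first.
  move=> j Hj; have := l0 j; have := l0 j.+1; have := l3 0 j; have := l3 0 j.+1.
  case: (l 0 j) (l 0 j.+1) => [|[|[|u]]] // [|[|[|v]]] // ? ? H1 H2;
    (by move: (H1 ltac:(lia))) || (by move: (H2 ltac:(lia))) || by [].
rewrite (@winding_linear Posz) //; last first.
  move=> j Hj; have := lM j; have := lM j.+1; have := l3 j M; have := l3 j.+1 M.
  case: (l j M) (l j.+1 M) => [|[|[|u]]] // [|[|[|v]]] // ? ? H1 H2;
    (by move: (H1 ltac:(lia))) || (by move: (H2 ltac:(lia))) || by [].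
rewrite (@winding_linear (fun c => - Posz (c == 2)%N)%R) //; last first.
  move=> j Hj; have := ld j; have := ld j.+1; have := l3 j j; have := l3 j.+1 j.+1.
  case: (l j j) (l j.+1 j.+1) => [|[|[|u]]] // [|[|[|v]]] // ? ? H1 H2;
    (by move: (H1 ltac:(lia))) || (by move: (H2 ltac:(lia))) || by [].
have := l0 0 isT; have := l0 M (leqnn M); have := lM 0 isT; have := lM M (leqnn M).
have := ld 0 isT; have := ld M (leqnn M); have := l3 0 M; have := l3 0 0; have := l3 M M.
lia.
Qed.

(** * Lifting a 3-colouring of a square grid to the integers *)

(** [h] lifts the colouring [F] from the integers modulo 3 to the integers.  It is
required to be continuous only along the columns in [GX] and the rows in [GZ]. *)
Definition grid_lift m (F : nat -> nat -> nat) (GX GZ : {set 'I_m})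
    (h : nat -> nat -> int) : Prop :=
  [/\ forall x z, exists q : int, h x z = (Posz (F x z) + 3 * q)%R,
      forall (x : nat) (z : 'I_m), z \in GZ -> x.+1 < m ->
        (`|h x.+1 z - h x z| <= 1)%R
    & forall (x : 'I_m) (z : nat), x \in GX -> z.+1 < m ->
        (`|h x z.+1 - h x z| <= 1)%R].

(** Integrate [turn] from the corner of the plane y = b to (x,b,z) inside that
plane, where the result does not depend on the way, then go down to (x,0,z).
Flatness of the plane x = a (resp. z = a) makes neighbouring descents along
this plane agree with the steps at y = 0. *)
Lemma grid_lift_exists m b (F : nat -> nat -> nat -> nat) (GX GZ : {set 'I_m}) :
  (forall x y z, F x y z < 3) ->
  (forall x z, x.+1 < m -> z.+1 < m ->
     flat (F x b z) (F x.+1 b z) (F x b z.+1) (F x.+1 b z.+1)) ->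
  (forall (x : 'I_m) y z, x \in GX -> y < b -> z.+1 < m ->
     flat (F x y z) (F x y z.+1) (F x y.+1 z) (F x y.+1 z.+1)) ->
  (forall x y (z : 'I_m), z \in GZ -> y < b -> x.+1 < m ->
     flat (F x y z) (F x.+1 y z) (F x y.+1 z) (F x.+1 y.+1 z)) ->
  exists h, grid_lift (fun x z => F x 0 z) GX GZ h.
Proof.
move=> F3 flatb flatx flatz.
pose column x z := winding (fun y => F x y z) 0 b.
pose base x z := (Posz (F 0%N b 0%N) + winding (fun j => F 0%N b j) 0 z +
  winding (fun i => F i b z) 0 x)%R.
have base_x x z : base x.+1 z = (base x z + turn (F x b z) (F x.+1 b z))%R.
  by rewrite /base winding_recr // addrA.
have base_z x z : x < m -> z.+1 < m ->
  base x z.+1 = (base x z + turn (F x b z) (F x b z.+1))%R.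
  move=> xm zm.
  have S : (turn (F 0%N b z) (F 0%N b z.+1) + winding (fun i => F i b z.+1) 0 x =
      winding (fun i => F i b z) 0 x + turn (F x b z) (F x b z.+1))%R.
    apply: (@winding_strip (fun i => F i b z) (fun i => F i b z.+1)) => // i /= ix.
    by rewrite /flat -flatb //; apply: leq_ltn_trans xm.
  rewrite /base winding_recr //; move: S; lia.
exists (fun x z => base x z - column x z)%R; split.
- move=> x z; rewrite /base /column.
  have [q1 ->] := winding_mod (F3 0 b) (leq0n z).
  have [q2 ->] := winding_mod (fun i => F3 i b z) (leq0n x).
  have [q3 ->] := winding_mod (fun y => F3 x y z) (leq0n b).
  exists (q1 + q2 - q3)%R; lia.
- move=> x z zG xm; have := turn_le1 (F x 0 z) (F x.+1 0 z).
  have S : (turn (F x 0%N z) (F x.+1 0%N z) + column x.+1 z =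
      column x z + turn (F x b z) (F x.+1 b z))%R.
    apply: (@winding_strip (fun y => F x y z) (fun y => F x.+1 y z)) => // y.
    by move=> /= yb; apply: flatz.
  by rewrite base_x; move: S; lia.
- move=> x z xG zm; have := turn_le1 (F x 0 z) (F x 0 z.+1).
  have S : (turn (F x 0%N z) (F x 0%N z.+1) + column x z.+1 =
      column x z + turn (F x b z) (F x b z.+1))%R.
    apply: (@winding_strip (fun y => F x y z) (fun y => F x y z.+1)) => // y.
    by move=> /= yb; apply: flatx.
  by rewrite base_z //; move: S; lia.
Qed.

Definition cross_lines m (GX GZ : {set 'I_m}) : {set 'I_m * 'I_m} :=
  [set u | (u.1 \in GX) || (u.2 \in GZ)].

(** Every good row meets every good column, so the union of the good lines is
connected. *)
Lemma lines_constant m (d : nat -> nat -> int) (GX GZ : {set 'I_m}) :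
  0 < #|GX| -> 0 < #|GZ| ->
  (forall x (z : 'I_m), z \in GZ -> x.+1 < m -> d x.+1 z = d x z) ->
  (forall (x : 'I_m) z, x \in GX -> z.+1 < m -> d x z.+1 = d x z) ->
  exists c, forall u, u \in cross_lines GX GZ -> d u.1 u.2 = c.
Proof.
move=> /card_gt0P[x0 x0G] /card_gt0P[z0 z0G] dx dz.
have rowc x (z : 'I_m) : z \in GZ -> x < m -> d x z = d 0 z.
  by move=> zG; elim: x => // x IH xm; rewrite dx // IH // ltnW.
have colc (x : 'I_m) z : x \in GX -> z < m -> d x z = d x 0.
  by move=> xG; elim: z => // z IH zm; rewrite dz // IH // ltnW.
have onz x (z : 'I_m) : z \in GZ -> x < m -> d x z = d x0 0.
  by move=> zG xm; rewrite rowc // -(rowc x0) // colc.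
exists (d x0 0) => -[x z] /=; rewrite inE /= => /orP[xG|zG]; last exact: onz.
by rewrite colc // -(colc x z0) // onz.
Qed.

(** Two lifts differ by a multiple of 3 that changes by at most 2 at each step,
hence not at all. *)
Lemma grid_lift_unique m (F F' : nat -> nat -> nat) (GX GZ : {set 'I_m}) h h' :
  0 < #|GX| -> 0 < #|GZ| ->
  (forall u, u \in cross_lines GX GZ -> F u.1 u.2 = F' u.1 u.2) ->
  grid_lift F GX GZ h -> grid_lift F' GX GZ h' ->
  exists c : int, forall u, u \in cross_lines GX GZ ->
    (h' u.1 u.2 = h u.1 u.2 + 3 * c)%R.
Proof.
move=> GX0 GZ0 eqF [hF hx hz] [hF' hx' hz'].
have d3 u : u \in cross_lines GX GZ -> exists q : int, (h' u.1 u.2 - h u.1 u.2 = 3 * q)%R.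
  move=> uG; have [q ->] := hF u.1 u.2; have [q' ->] := hF' u.1 u.2.
  by exists (q' - q)%R; rewrite eqF //; lia.
have inx (x : 'I_m) z (zm : z < m) : x \in GX -> (x, Ordinal zm) \in cross_lines GX GZ.
  by rewrite inE /= => ->.
have inz x (xm : x < m) (z : 'I_m) : z \in GZ -> (Ordinal xm, z) \in cross_lines GX GZ.
  by rewrite inE /= => ->; rewrite orbT.
have [||c Hc] := @lines_constant m (fun x z => h' x z - h x z)%R GX GZ GX0 GZ0.
- move=> x z zG xm; have := hx x z zG xm; have := hx' x z zG xm.
  have /= [q Eq] := d3 _ (inz _ xm _ zG); have /= [q' Eq'] := d3 _ (inz _ (ltnW xm) _ zG).
  move: Eq Eq'; lia.
- move=> x z xG zm; have := hz x z xG zm; have := hz' x z xG zm.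
  have /= [q Eq] := d3 _ (inx _ _ zm xG); have /= [q' Eq'] := d3 _ (inx _ _ (ltnW zm) xG).
  move: Eq Eq'; lia.
have [x0 x0G] := card_gt0P GX0; have [z0 z0G] := card_gt0P GZ0.
have x0z0 : (x0, z0) \in cross_lines GX GZ by rewrite inE /= x0G.
have [q Eq] := d3 _ x0z0.
exists q => u uG; have := Hc _ uG; have := Hc _ x0z0; move: Eq; lia.
Qed.

(** * Medians of lifts *)

Lemma median_exists (T : finType) (V : {set T}) (h : T -> int) : 0 < #|V| ->
  exists2 v, v \in V & 2 * #|[set u in V | (h u < h v)%R]| <= #|V| /\
                       2 * #|[set u in V | (h v < h u)%R]| <= #|V|.
Proof.
move=> /card_gt0P[v0 v0V].
pose P v := (v \in V) && (2 * #|[set u in V | (h v < h u)%R]| <= #|V|).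
have [top topV topmax] : exists2 v, v \in V & forall u, u \in V -> (h u <= h v)%R.
  by case: (arg_maxP h v0V) => v vV vmax; exists v.
have Ptop : P top.
  rewrite /P topV; have -> : [set u in V | (h top < h u)%R] = set0.
    by apply/setP=> u; rewrite !inE; apply/negP=> /andP[/topmax]; lia.
  by rewrite cards0.
(* A median is a lowest point having at most half of the points above it. *)
have [v Pv vmin] := arg_minP h Ptop; have /andP[vV vup] := Pv.
exists v => //; split=> //; rewrite leqNgt; apply/negP=> big.
have /card_gt0P[w0 w0L] : 0 < #|[set u in V | (h u < h v)%R]| by lia.
have [w wL wmax] : exists2 w, w \in [set u in V | (h u < h v)%R] &
    forall u, u \in [set u in V | (h u < h v)%R] -> (h u <= h w)%R.
  by case: (arg_maxP h w0L) => w wL wmax; exists w.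
move: (wL); rewrite inE => /andP[wV wv].
have Pw : P w.
  rewrite /P wV /=.
  have := cardsID [set u in V | (h u < h v)%R] V.
  have -> : V :&: [set u in V | (h u < h v)%R] = [set u in V | (h u < h v)%R].
    by apply/setP=> u; rewrite !inE andbA andbb.
  have /subset_leq_card : [set u in V | (h w < h u)%R] \subset V :\: [set u in V | (h u < h v)%R].
    apply/subsetP=> u; rewrite !inE => /andP[uV wu]; rewrite uV /= andbT.
    apply/negP=> uv; have := wmax u; rewrite inE uV uv => /(_ isT); lia.
  lia.
have := vmin w Pw; lia.
Qed.

(** A 1-Lipschitz walk cannot jump over a gap of width two. *)
Lemma line_one_sided m (g : nat -> int) (k k' : int) :
  (k + 2 <= k')%R ->
  (forall x, x < m -> ~~ ((k < g x)%R && (g x < k')%R)) ->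
  (forall x, x.+1 < m -> (`|g x.+1 - g x| <= 1)%R) ->
  forall x y, x < m -> y < m -> (g x <= k)%R -> (g y <= k)%R.
Proof.
move=> kk' gap lip.
have side x : x < m -> (g x <= k)%R = (g 0 <= k)%R.
  elim: x => // x IH xm; rewrite -IH ?(ltnW xm) //.
  have := gap x (ltnW xm); have := gap _ xm; have := lip _ xm; lia.
by move=> x y xm ym; rewrite !side.
Qed.

(** Suppose [k + 2 <= k'].  At most half of the points are above [k] and at most
half are below [k'], so at most [e ^ 2] points of good lines lie strictly in between,
[e ^ 2] being the bound for the number of points on no good line.  A good line without such a
point is entirely low or entirely high.  A column of this kind meets all rows of
this kind and makes them all low or all high, so the other kind, nearly half of
the points, would fit into few rows. *)
Lemma medians_close m e (GX GZ : {set 'I_m}) F h (k k' : int) :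
  2 * (e + 2 * e ^ 2) < m -> #|~: GX| <= e -> #|~: GZ| <= e ->
  grid_lift F GX GZ h ->
  2 * #|[set u in cross_lines GX GZ | (k < h u.1 u.2)%R]| <= m * m ->
  2 * #|[set u in cross_lines GX GZ | (h u.1 u.2 < k')%R]| <= m * m ->
  (k' < k + 2)%R.
Proof.
move=> em eX eZ [_ hx hz] above below; rewrite ltNge; apply/negP=> kk'.
set V := cross_lines GX GZ in above below.
pose Mid := [set u in V | (k < h u.1 u.2)%R && (h u.1 u.2 < k')%R].
pose Lo := [set u in V | (h u.1 u.2 <= k)%R].
pose Hi := [set u in V | (k' <= h u.1 u.2)%R].
(* A point off all good lines has both coordinates bad. *)
have V_large : m * m <= #|V| + e ^ 2.
  have := cardsC V; rewrite card_prod card_ord => <-; rewrite leq_add2l.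
  have /subset_leq_card : ~: V \subset setX (~: GX) (~: GZ).
    by apply/subsetP=> u; rewrite !inE negb_or.
  rewrite cardsX => /leq_trans; apply; rewrite -mulnn; exact: leq_mul.
have LoMid : #|V| = #|Lo| + #|[set u in V | (k < h u.1 u.2)%R]|.
  rewrite -(cardsID Lo V); congr (_ + _); apply: eq_card => u; rewrite !inE;
    case: (_ || _) => //=; lia.
have HiMid : #|V| = #|Hi| + #|[set u in V | (h u.1 u.2 < k')%R]|.
  rewrite -(cardsID Hi V); congr (_ + _); apply: eq_card => u; rewrite !inE;
    case: (_ || _) => //=; lia.
have MidHi : #|[set u in V | (k < h u.1 u.2)%R]| = #|Mid| + #|Hi|.
  rewrite -(cardsID Hi [set u in V | (k < h u.1 u.2)%R]) addnC.
  congr (_ + _); apply: eq_card => u; rewrite !inE;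
    case: (_ || _) => //=; lia.
pose BX := ~: GX :|: [set u.1 | u in Mid].
pose BZ := ~: GZ :|: [set u.2 | u in Mid].
have MidE : #|Mid| <= e ^ 2 by lia.
have BXe : #|BX| <= e + e ^ 2.
  apply: leq_trans (leq_card_setU _ _) _; apply: leq_add => //.
  exact: leq_trans (leq_imset_card _ _) MidE.
have BZe : #|BZ| <= e + e ^ 2.
  apply: leq_trans (leq_card_setU _ _) _; apply: leq_add => //.
  exact: leq_trans (leq_imset_card _ _) MidE.
have row (z : 'I_m) x y : z \notin BZ -> x < m -> y < m -> (h x z <= k)%R -> (h y z <= k)%R.
  rewrite !inE negb_or negbK => /andP[zG zM].
  apply: (line_one_sided (g := fun x => h x z) kk') => [i im|i]; last exact: hx.
  apply: contra zM => mid; apply/imsetP; exists (Ordinal im, z) => //.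
  by rewrite !inE zG orbT.
have col (x : 'I_m) y z : x \notin BX -> y < m -> z < m -> (h x y <= k)%R -> (h x z <= k)%R.
  rewrite !inE negb_or negbK => /andP[xG xM].
  apply: (line_one_sided (g := h x) kk') => [i im|i]; last exact: hz.
  apply: contra xM => mid; apply/imsetP; exists (x, Ordinal im) => //.
  by rewrite !inE xG.
have [x0 x0B] : exists x0, x0 \notin BX.
  have /card_gt0P[x0] : 0 < #|~: BX| by have := cardsC BX; rewrite card_ord; lia.
  by rewrite inE; exists x0.
have strip (S : {set 'I_m * 'I_m}) : (forall u, u \in S -> u.2 \in BZ) -> #|S| <= m * (e + e ^ 2).
  move=> SB; have /subset_leq_card : S \subset setX setT BZ.
    by apply/subsetP=> u /SB; rewrite !inE.
  by rewrite cardsX cardsT card_ord => /leq_trans; apply; rewrite leq_mul2l BZe orbT.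
have m0 : 0 < m by lia.
have notmid u : u \in V -> u.2 \notin BZ -> (k < h u.1 u.2)%R -> (k' <= h u.1 u.2)%R.
  move=> uV; rewrite !inE negb_or => /andP[_ uM] ku; rewrite leNgt; apply: contra uM => uk.
  by apply/imsetP; exists u => //; rewrite inE uV ku uk.
have budget : 2 * (m * (e + e ^ 2)) + 2 * e ^ 2 < m * m.
  have : m * (2 * (e + 2 * e ^ 2) + 1) <= m * m by rewrite leq_mul2l addn1 em orbT.
  have : e ^ 2 <= m * e ^ 2 by rewrite leq_pmull.
  by rewrite !mulnDr !(mulnCA m); lia.
case: (lerP (h x0 0) k) => x0k.
  have /strip : forall u, u \in Hi -> u.2 \in BZ.
    move=> u; rewrite inE => /andP[uV uk]; apply/negPn/negP=> uB.
    have := row _ x0 u.1 uB (ltn_ord _) (ltn_ord _) (col x0 0 u.2 x0B m0 (ltn_ord _) x0k).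
    by move=> /(le_trans uk)/(le_trans kk'); lia.
  lia.
have /strip : forall u, u \in Lo -> u.2 \in BZ.
  move=> u; rewrite inE => /andP[uV uk]; apply/negPn/negP=> uB.
  have := col x0 u.2 0 x0B (ltn_ord _) m0 (row _ u.1 x0 uB (ltn_ord _) (ltn_ord _) uk).
  by move=> /(lt_le_trans x0k); rewrite ltxx.
lia.
Qed.

(** The colour at a median of some lift.  Asking for the existence of a lift is
harmless because lifts are unique up to translation; [K] bounds the number of
lines left out in each direction. *)
Definition dominant m K (F : nat -> nat -> nat) (c : nat) : Prop :=
  exists (GX GZ : {set 'I_m}) (h : nat -> nat -> int) (v : 'I_m * 'I_m),
  [/\ #|~: GX| <= K /\ #|~: GZ| <= K, grid_lift F GX GZ h, F v.1 v.2 = c,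
      2 * #|[set u in cross_lines GX GZ | (h u.1 u.2 < h v.1 v.2)%R]| <= m * m
    & 2 * #|[set u in cross_lines GX GZ | (h v.1 v.2 < h u.1 u.2)%R]| <= m * m].

Lemma dominant_exists m K F (GX GZ : {set 'I_m}) h :
  K < m -> #|~: GX| <= K -> #|~: GZ| <= K -> grid_lift F GX GZ h ->
  exists u : 'I_m * 'I_m, dominant m K F (F u.1 u.2).
Proof.
move=> Km KX KZ lift.
have V0 : 0 < #|cross_lines GX GZ|.
  have /card_gt0P[x xG] : 0 < #|GX| by have := cardsC GX; rewrite card_ord; lia.
  by apply/card_gt0P; exists (x, x); rewrite inE xG.
have [v _ [vlo vhi]] := median_exists (fun u : 'I_m * 'I_m => h u.1 u.2) V0.
have Vm : #|cross_lines GX GZ| <= m * m.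
  by have := max_card (mem (cross_lines GX GZ)); rewrite card_prod card_ord.
exists v, GX, GZ, h, v; split=> //; exact: leq_trans Vm.
Qed.

Lemma cross_linesS m (GX GX' GZ GZ' : {set 'I_m}) : GX \subset GX' -> GZ \subset GZ' ->
  cross_lines GX GZ \subset cross_lines GX' GZ'.
Proof.
move=> /subsetP sX /subsetP sZ; apply/subsetP=> u; rewrite !inE.
by case/orP=> [/sX|/sZ] ->; rewrite ?orbT.
Qed.

Lemma grid_liftS m F (GX GX' GZ GZ' : {set 'I_m}) h : GX \subset GX' -> GZ \subset GZ' ->
  grid_lift F GX' GZ' h -> grid_lift F GX GZ h.
Proof.
move=> /subsetP sX /subsetP sZ [hF hx hz]; split=> // [x z /sZ|x z /sX]; [exact: hx|exact: hz].
Qed.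

(** By uniqueness of lifts a median for [F'] becomes, after a shift by a multiple
of 3, a median for the lift of any colouring equal to [F'] on good lines.  The
shift does not change its colour. *)
Lemma median_transfer m (F F' : nat -> nat -> nat) (GX GX' GZ GZ' : {set 'I_m})
    (h h' : nat -> nat -> int) (v : 'I_m * 'I_m) :
  GX \subset GX' -> GZ \subset GZ' -> 0 < #|GX| -> 0 < #|GZ| ->
  (forall u, u \in cross_lines GX GZ -> F u.1 u.2 = F' u.1 u.2) ->
  grid_lift F GX GZ h -> grid_lift F' GX' GZ' h' ->
  2 * #|[set u in cross_lines GX' GZ' | (h' u.1 u.2 < h' v.1 v.2)%R]| <= m * m ->
  2 * #|[set u in cross_lines GX' GZ' | (h' v.1 v.2 < h' u.1 u.2)%R]| <= m * m ->
  exists k q : int, [/\ (k = Posz (F' v.1 v.2) + 3 * q)%R,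
    2 * #|[set u in cross_lines GX GZ | (h u.1 u.2 < k)%R]| <= m * m &
    2 * #|[set u in cross_lines GX GZ | (k < h u.1 u.2)%R]| <= m * m].
Proof.
move=> sX sZ GX0 GZ0 eqF lift lift' lo hi.
have [c Hc] := grid_lift_unique GX0 GZ0 eqF lift (grid_liftS sX sZ lift').
have /subsetP sV := cross_linesS sX sZ.
have [hF' _ _] := lift'; have [q Eq] := hF' v.1 v.2.
exists (h' v.1 v.2 - 3 * c)%R, (q - c)%R; split; first by rewrite Eq; lia.
  apply: leq_trans lo; rewrite leq_mul2l; apply: subset_leq_card.
  apply/subsetP=> u; rewrite in_set => /andP[uV uk]; rewrite in_set sV //=.
  have := Hc u uV; move: uk; move: (h' u.1 u.2) (h' v.1 v.2) (h u.1 u.2) => a b d; lia.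
apply: leq_trans hi; rewrite leq_mul2l; apply: subset_leq_card.
apply/subsetP=> u; rewrite in_set => /andP[uV uk]; rewrite in_set sV //=.
have := Hc u uV; move: uk; move: (h' u.1 u.2) (h' v.1 v.2) (h u.1 u.2) => a b d; lia.
Qed.

(** On the lines that are good for all three colourings and avoid [B] there is a
single lift.  It would have three medians, pairwise incongruent modulo 3, hence
two of them at distance at least 2. *)
Lemma dominant_not_rainbow m K (B : {set 'I_m * 'I_m})
    (F0 F1 F2 : nat -> nat -> nat) (c0 c1 c2 : nat) :
  let e := 3 * K + 2 in 2 * (e + 2 * e ^ 2) < m -> #|B| <= 2 ->
  (forall u : 'I_m * 'I_m, u \notin B -> F0 u.1 u.2 = F1 u.1 u.2) ->
  (forall u : 'I_m * 'I_m, u \notin B -> F0 u.1 u.2 = F2 u.1 u.2) ->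
  dominant m K F0 c0 -> dominant m K F1 c1 -> dominant m K F2 c2 ->
  c0 < 3 -> c1 < 3 -> c2 < 3 -> ~~ uniq [:: c0; c1; c2].
Proof.
move=> e em B2 F01 F02.
case=> X0 [Z0 [h0 [v0 [[X0K Z0K] l0 <- lo0 hi0]]]].
case=> X1 [Z1 [h1 [v1 [[X1K Z1K] l1 <- lo1 hi1]]]].
case=> X2 [Z2 [h2 [v2 [[X2K Z2K] l2 <- lo2 hi2]]]] c03 c13 c23.
pose GX := X0 :&: X1 :&: X2 :\: [set u.1 | u in B].
pose GZ := Z0 :&: Z1 :&: Z2 :\: [set u.2 | u in B].
have card4 (S0 S1 S2 D : {set 'I_m}) : #|~: S0| <= K -> #|~: S1| <= K -> #|~: S2| <= K ->
    #|D| <= 2 -> #|~: (S0 :&: S1 :&: S2 :\: D)| <= e.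
  move=> s0 s1 s2 d; rewrite setCD !setCI.
  have le_card := fun A A' : {set 'I_m} => (leq_card_setU A A').1.
  have := le_card (~: S0 :|: ~: S1 :|: ~: S2) D.
  have := le_card (~: S0 :|: ~: S1) (~: S2).
  have := le_card (~: S0) (~: S1); rewrite /e; lia.
have GXe : #|~: GX| <= e by apply: card4 => //; apply: leq_trans (leq_imset_card _ _) B2.
have GZe : #|~: GZ| <= e by apply: card4 => //; apply: leq_trans (leq_imset_card _ _) B2.
have large (S : {set 'I_m}) : #|~: S| <= e -> 0 < #|S|.
  have := cardsC S; rewrite card_ord; move: em; move: (e) => e'; lia.
have [GX0 GZ0] := (large _ GXe, large _ GZe).
have sX : [/\ GX \subset X0, GX \subset X1 & GX \subset X2].
  by split; apply/subsetP=> x; rewrite !inE => /andP[_ /andP[/andP[]]].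
have sZ : [/\ GZ \subset Z0, GZ \subset Z1 & GZ \subset Z2].
  by split; apply/subsetP=> x; rewrite !inE => /andP[_ /andP[/andP[]]].
have VB u : u \in cross_lines GX GZ -> u \notin B.
  apply: contraL => uB; rewrite !inE !negb_or !negb_and !negbK.
  by rewrite !imset_f.
have [sX0 sX1 sX2] := sX; have [sZ0 sZ1 sZ2] := sZ.
have lift := grid_liftS sX0 sZ0 l0.
have [k0 [q0 [E0 klo0 khi0]]] :=
  median_transfer sX0 sZ0 GX0 GZ0 (fun _ _ => erefl) lift l0 lo0 hi0.
have [k1 [q1 [E1 klo1 khi1]]] :=
  median_transfer sX1 sZ1 GX0 GZ0 (fun u uV => F01 u (VB u uV)) lift l1 lo1 hi1.
have [k2 [q2 [E2 klo2 khi2]]] :=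
  median_transfer sX2 sZ2 GX0 GZ0 (fun u uV => F02 u (VB u uV)) lift l2 lo2 hi2.
have close := medians_close em GXe GZe lift.
have := close _ _ khi0 klo1; have := close _ _ khi0 klo2; have := close _ _ khi1 klo0.
have := close _ _ khi1 klo2; have := close _ _ khi2 klo0; have := close _ _ khi2 klo1.
rewrite /= !inE; lia.
Qed.

(** * Rainbow triangles in stack layouts *)

Definition order_rank (T : finType) (L : {set T * T}) (v : T) : nat :=
  #|[set u | ord_lt L u v]|.

Lemma order_rankP (T : finType) (L : {set T * T}) : total_order L ->
  forall u v, (order_rank L u < order_rank L v) = ord_lt L u v.
Proof.
move=> tL; have [_ anti trans tot] := total_orderP L tL.
have mono u v : ord_lt L u v -> order_rank L u < order_rank L v.
  move=> uv; have /andP[uNv luv] := uv; apply: proper_card; apply/properP; split.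
    apply/subsetP=> w; rewrite !inE => /andP[wNu lwu].
    rewrite /ord_lt (trans _ _ _ lwu luv) andbT.
    by apply: contraNneq uNv => wv; apply/eqP/anti; rewrite luv -wv.
  by exists u; rewrite !inE ?uv // /ord_lt eqxx.
move=> u v; apply/idP/idP; last exact: mono.
case: (eqVneq u v) => [->|uNv]; first by rewrite ltnn.
have /orP[luv|lvu] := tot u v; first by rewrite /ord_lt uNv luv.
move=> uv; have := mono v u; rewrite /ord_lt eq_sym uNv lvu => /(_ isT).
by move/(ltn_trans uv); rewrite ltnn.
Qed.

Lemma order_rank_inj (T : finType) (L : {set T * T}) : total_order L ->
  injective (order_rank L).
Proof.
move=> tL u v ruv; have [_ _ _ tot] := total_orderP L tL.
apply/eqP; apply: contraT => uNv.
have := order_rankP tL u v; have := order_rankP tL v u.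
rewrite ruv ltnn /ord_lt uNv eq_sym uNv /= => vu uv.
by have := tot u v; rewrite -vu -uv.
Qed.

Lemma order_rank_lt (T : finType) (L : {set T * T}) v : order_rank L v < #|T|.
Proof.
rewrite -cardsT; apply: proper_card; apply/properP; split; first exact: subsetT.
by exists v; rewrite !inE // /ord_lt eqxx.
Qed.

(** Total in [a] and [b]: the value is [None] when they are not adjacent. *)
Definition page (G : sgraph) k (phi : {ffun edge G -> 'I_k}) (a b : G) : option 'I_k :=
  omap phi (insub [set a; b]).

Lemma mem_edges (G : sgraph) (a b : G) : adj a b -> [set a; b] \in edges G.
Proof. by move=> ab; apply/imsetP; exists (a, b); rewrite ?inE. Qed.

Lemma page_twist (G : sgraph) k L (phi : {ffun edge G -> 'I_k}) (a b c d : G) :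
  stack_layout L phi -> adj a c -> adj b d ->
  order_rank L a < order_rank L b -> order_rank L b < order_rank L c ->
  order_rank L c < order_rank L d -> page phi a c != page phi b d.
Proof.
case/andP=> tL /forallP nocross /mem_edges ac /mem_edges bd.
rewrite !order_rankP // => ab bc cd.
rewrite /page (@insubT _ (fun e => e \in edges G) (edge G) _ ac).
rewrite (@insubT _ (fun e => e \in edges G) (edge G) _ bd) /=; apply/eqP => -[] /eqP same.
have /forallP/(_ (Sub [set b; d] bd)) := nocross (Sub [set a; c] ac).
rewrite same /= => /negP[].
apply/existsP; exists a; apply/existsP; exists c; apply/existsP; exists b.
apply/existsP; exists d; rewrite /oriented !eqxx /= ab bc cd.
have lt_trans x y z : ord_lt L x y -> ord_lt L y z -> ord_lt L x z.
  by rewrite -!order_rankP //; apply: ltn_trans.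
by rewrite (lt_trans _ _ _ ab bc) (lt_trans _ _ _ bc cd).
Qed.

(** The level sets of [coord] play the role of parallel planes. *)
Definition rainbow_at (G : sgraph) (col coord : G -> nat) (i : nat) (w : G * G * G) : bool :=
  let: (a, b, c) := w in
  [&& adj a b, adj b c, adj a c, col a == 0, col b == 1, col c == 2,
      coord a == i, coord b == i & coord c == i].

(** Choose a rainbow triangle in each plane that has one.  Its three pages
determine the plane: triangles in different planes share no vertex, and among
the orders in which the three colour classes list two triangles, two agree, so
that the edges between these two classes cross. *)
Lemma few_rainbow_planes (G : sgraph) k L (phi : {ffun edge G -> 'I_k})
    (col coord : G -> nat) n :
  stack_layout L phi ->
  (forall u v, col u < col v -> order_rank L u < order_rank L v) ->
  #|[set i : 'I_n | [exists w, rainbow_at col coord i w]]| <= k.+1 ^ 3.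
Proof.
move=> lay mono; set P := [set i | _].
pose pages (i : 'I_n) := if [pick w | rainbow_at col coord i w] is Some (a, b, c)
  then (page phi a b, page phi b c, page phi a c) else (None, None, None).
have -> : k.+1 ^ 3 = #|{: option 'I_k * option 'I_k * option 'I_k}|.
  by rewrite !card_prod !card_option card_ord; lia.
rewrite -(card_in_imset (f := pages)); first exact: max_card.
have tL : total_order L by have /andP[] := lay.
move=> i j; rewrite !inE /pages => /existsP[w Hw] /existsP[w' Hw'].
case: pickP => [[[a b] c]|/(_ w)]; last by rewrite Hw.
case/and5P=> ab bc ac /eqP a0 /and5P[/eqP b1 /eqP c2 /eqP ai /eqP bi /eqP ci].
case: pickP => [[[a' b'] c']|/(_ w')]; last by rewrite Hw'.
case/and5P=> ab' bc' ac' /eqP a0' /and5P[/eqP b1' /eqP c2' /eqP ai' /eqP bi' /eqP ci'].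
case=> pab pbc pac; apply: val_inj => /=; apply/eqP; apply: contraT => iNj.
have ne u v : coord u = i -> coord v = j ->
    (order_rank L u < order_rank L v) || (order_rank L v < order_rank L u).
  move=> ui vj; rewrite -neq_ltn; apply: contra iNj => /eqP/(order_rank_inj tL) uv.
  by rewrite -ui -vj uv.
have twist x y x' y' : adj x y -> adj x' y' -> page phi x y = page phi x' y' ->
    col x' < col y -> order_rank L x < order_rank L x' ->
    order_rank L y < order_rank L y' -> False.
  move=> xy xy' same /mono x'y xx' yy'.
  by have := page_twist lay xy xy' xx' x'y yy'; rewrite same eqxx.
have T1 := twist _ _ _ _ ab ab' pab; have T1' := twist _ _ _ _ ab' ab (esym pab).
have T2 := twist _ _ _ _ bc bc' pbc; have T2' := twist _ _ _ _ bc' bc (esym pbc).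
have T3 := twist _ _ _ _ ac ac' pac; have T3' := twist _ _ _ _ ac' ac (esym pac).
rewrite a0 a0' b1 b1' c2 c2' in T1 T1' T2 T2' T3 T3'.
have {}T1 := T1 isT; have {}T1' := T1' isT; have {}T2 := T2 isT.
have {}T2' := T2' isT; have {}T3 := T3 isT; have {}T3' := T3' isT.
case/orP: (ne a a' ai ai') => A; case/orP: (ne b b' bi bi') => B;
  case/orP: (ne c c' ci ci') => C;
  by [case: (T1 A B)|case: (T1' A B)|case: (T2 B C)|case: (T2' B C)
     |case: (T3 A C)|case: (T3' A C)].
Qed.

(** * A graph with three queues *)

Definition gap N d := [|| d == N, d == N.+1, d == N ^ 2, d == (N ^ 2).+1,
                          d == N ^ 2 + N | d == (N ^ 2 + N).+1].

Definition gap_rel N : rel 'I_(N ^ 3).+1 := fun u v => gap N (v - u) || gap N (u - v).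

Lemma gap_rel_sym N : symmetric (@gap_rel N).
Proof. by move=> u v; rewrite /gap_rel orbC. Qed.

Lemma gap_rel_irr N : 0 < N -> irreflexive (@gap_rel N).
Proof.
move=> N0 u; rewrite /gap_rel subnn orbb /gap.
have : 0 < N ^ 2 by rewrite expn_gt0 N0.
lia.
Qed.

Definition gap_graph N : sgraph := SGraph (@gap_rel_sym N.+1) (gap_rel_irr (ltn0Sn N)).

Definition edge_length n (e : {set 'I_n}) : nat :=
  \max_(a in e) \max_(b in e) (a - b).

Lemma edge_length_pair n (a b : 'I_n) : a < b -> edge_length [set a; b] = b - a.
Proof.
move=> ab; have aNb : a != b by apply: contraTneq ab => ->; rewrite ltnn.
have pair (F : 'I_n -> nat) : \max_(x in [set a; b]) F x = maxn (F a) (F b).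
  by rewrite big_setU1 ?inE // big_set1.
by rewrite /edge_length !pair !subnn; lia.
Qed.

(** If one edge is nested in another then the lengths differ by at least 2, but the
lengths in a queue are two consecutive integers. *)
Lemma gap_graph_queue N : has_queue_layout (gap_graph N.+1) 3.
Proof.
set G := gap_graph _; pose M := N.+2.
pose L : {set G * G} := [set p : G * G | (p.1 : 'I__) <= (p.2 : 'I__)].
pose queue (d : nat) : 'I_3 :=
  if d < M.+2 then ord0 else if d < (M ^ 2).+2 then inord 1 else inord 2.
pose phi : {ffun edge G -> 'I_3} := [ffun e => queue (edge_length (val e))].
apply/existsP; exists L; apply/existsP; exists phi.
have ltL (a b : G) : ord_lt L a b = ((a : 'I__) < (b : 'I__)).
  by rewrite /ord_lt /ord_le inE /= ltn_neqAle.
apply/andP; split.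
  apply/total_orderP; split=> [a|a b|b a c|a b]; rewrite /ord_le !inE /= ?leqnn //.
  - by rewrite -eqn_leq => /eqP/val_inj.
  - exact: leq_trans.
  - exact: leq_total.
have gap0 d : gap M d -> 0 < d.
  by have := gap_rel_irr (ltn0Sn N.+1) ord0; rewrite /gap_rel orbb; case: d => [->|].
have len (e : edge G) a b : oriented L (val e) a b ->
    edge_length (val e) = b - a /\ gap M (b - a).
  case/andP=> /eqP eab; rewrite ltL => ab; rewrite eab edge_length_pair //; split=> //.
  have /imsetP[[x y]] := valP e; rewrite eab inE /= => xy eq2.
  have : a \in [set x; y] by rewrite -eq2 set21.
  have : b \in [set x; y] by rewrite -eq2 set22.
  have ba0 : gap M (a - b) = false.
    by apply/negP => /gap0; rewrite subn_gt0 ltnNge ltnW.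
  move: xy; rewrite /= /gap_rel !inE => xy /orP[]/eqP eb /orP[]/eqP ea.
  - by move: ab; rewrite ea eb ltnn.
  - by move: xy; rewrite -eb -ea ba0.
  - by move: xy; rewrite -eb -ea ba0 orbF.
  - by move: ab; rewrite ea eb ltnn.
have M2 : M.+2 <= M ^ 2 by rewrite /M; lia.
apply/forallP=> e1; apply/forallP=> e2; apply/implyP; rewrite !ffunE => /eqP same.
apply/negP=> /existsP[a /existsP[b /existsP[c /existsP[d]]]] /and3P[/len[l1 g1] /len[l2 g2]].
rewrite !ltL; move: same; rewrite l1 l2.
have queueE q : queue q = (M.+2 <= q) + ((M ^ 2).+2 <= q) :> nat.
  by rewrite /queue; case: ifP => ?; [|case: ifP => ?]; rewrite ?inordK //=; lia.
have sep d1 d2 : gap M d1 -> gap M d2 -> queue d1 = queue d2 -> d1 <= d2.+1.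
  by move=> h1 h2 /(congr1 val); rewrite /= !queueE; move: h1 h2; rewrite /gap; lia.
move=> same; have := sep _ _ g1 g2 same; have := sep _ _ g2 g1 (esym same); lia.
Qed.

(** * The triangulated box in the graph *)

(** [rainbow_at] fixes which corner has which colour; adjacency is symmetric, so
all six arrangements are covered. *)
Lemma not_rainbow (G : sgraph) (col coord : G -> nat) i (a b c : G) :
  (forall v, col v < 3) -> ~~ [exists w, rainbow_at col coord i w] ->
  adj a b -> adj b c -> adj a c -> coord a = i -> coord b = i -> coord c = i ->
  ~~ uniq [:: col a; col b; col c].
Proof.
move=> col3 /existsPn none ab bc ac ai bi ci.
have := col3 a; have := col3 b; have := col3 c.
have ba : adj b a by rewrite adj_sym.
have cb : adj c b by rewrite adj_sym.
have ca : adj c a by rewrite adj_sym.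
have := none (a, b, c); have := none (a, c, b); have := none (b, a, c).
have := none (b, c, a); have := none (c, a, b); have := none (c, b, a).
rewrite /rainbow_at ab bc ac ba cb ca ai bi ci !eqxx /= !inE; lia.
Qed.

Section Box.
Variable m : nat.

(* The base exceeds all sums of two coordinates below m. *)
Let W := (2 * m).+2.
Let G := gap_graph (2 * m).+1.

(** In base [W] the digits are x + z, x + y and x; these sums make the six steps
of the box differ by the gaps of the graph. *)
Definition box_vertex (x y z : nat) : G := inord (W ^ 2 * (x + z) + W * (x + y) + x).

Definition x_coord (v : G) : nat := v %% W.
Definition y_coord (v : G) : nat := (v %/ W) %% W - v %% W.
Definition z_coord (v : G) : nat := v %/ W ^ 2 - v %% W.

Section Coordinates.
Variables x y z : nat.
Hypotheses (xm : x < m) (ym : y < m) (zm : z < m).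

Lemma box_vertexE : box_vertex x y z = W ^ 2 * (x + z) + W * (x + y) + x :> nat.
Proof.
rewrite inordK // ltnS.
have : W ^ 2 * (x + z) <= W ^ 2 * W.-1 by rewrite leq_mul2l /W; lia.
have : W * (x + y) <= W * W.-1 by rewrite leq_mul2l /W; lia.
have -> : (2 * m).+2 ^ 3 = W ^ 2 * W.-1 + (W * W.-1 + W) by rewrite /W; lia.
rewrite /W; lia.
Qed.

Let digits : box_vertex x y z = ((x + z) * W + (x + y)) * W + x :> nat.
Proof. by rewrite box_vertexE; lia. Qed.

Let xW : x < W. Proof. by rewrite /W; lia. Qed.
Let xyW : x + y < W. Proof. by rewrite /W; lia. Qed.

Lemma x_coord_box : x_coord (box_vertex x y z) = x.
Proof. by rewrite /x_coord digits modnMDl modn_small. Qed.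

Let highE : box_vertex x y z %/ W = (x + z) * W + (x + y).
Proof. by rewrite digits divnMDl // divn_small // addn0. Qed.

Lemma y_coord_box : y_coord (box_vertex x y z) = y.
Proof.
rewrite /y_coord highE modnMDl (modn_small xyW).
by rewrite -[box_vertex x y z %% W]/(x_coord _) x_coord_box addKn.
Qed.

Lemma z_coord_box : z_coord (box_vertex x y z) = z.
Proof.
rewrite /z_coord -mulnn divnMA highE divnMDl // divn_small // addn0.
by rewrite -[box_vertex x y z %% W]/(x_coord _) x_coord_box addKn.
Qed.

End Coordinates.

Lemma gap_adj (u v : G) d : gap W d -> v = u + d :> nat -> adj u v.
Proof. by move=> Wd uv; rewrite /= /gap_rel uv addKn Wd. Qed.

Lemma box_adj_x x y z : x.+1 < m -> y < m -> z < m ->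
  adj (box_vertex x y z) (box_vertex x.+1 y z).
Proof.
move=> xm ym zm; apply: (gap_adj (d := (W ^ 2 + W).+1)).
  by rewrite /gap eqxx !orbT.
by rewrite !box_vertexE ?(ltnW xm) //; lia.
Qed.

Lemma box_adj_y x y z : x < m -> y.+1 < m -> z < m ->
  adj (box_vertex x y z) (box_vertex x y.+1 z).
Proof.
move=> xm ym zm; apply: (gap_adj (d := W)); first by rewrite /gap eqxx.
by rewrite !box_vertexE ?(ltnW ym) //; lia.
Qed.

Lemma box_adj_z x y z : x < m -> y < m -> z.+1 < m ->
  adj (box_vertex x y z) (box_vertex x y z.+1).
Proof.
move=> xm ym zm; apply: (gap_adj (d := W ^ 2)); first by rewrite /gap eqxx !orbT.
by rewrite !box_vertexE ?(ltnW zm) //; lia.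
Qed.

Lemma box_adj_yz x y z : x < m -> y.+1 < m -> z.+1 < m ->
  adj (box_vertex x y z) (box_vertex x y.+1 z.+1).
Proof.
move=> xm ym zm; apply: (gap_adj (d := W ^ 2 + W)); first by rewrite /gap eqxx !orbT.
by rewrite !box_vertexE ?(ltnW zm) ?(ltnW ym) //; lia.
Qed.

Lemma box_adj_xy x y z : x.+1 < m -> y.+1 < m -> z < m ->
  adj (box_vertex x.+1 y z) (box_vertex x y.+1 z).
Proof.
move=> xm ym zm; rewrite adj_sym; apply: (gap_adj (d := (W ^ 2).+1)).
  by rewrite /gap eqxx !orbT.
by rewrite !box_vertexE ?(ltnW xm) ?(ltnW ym) //; lia.
Qed.

Lemma box_adj_xz x y z : x.+1 < m -> y < m -> z.+1 < m ->
  adj (box_vertex x.+1 y z) (box_vertex x y z.+1).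
Proof.
move=> xm ym zm; rewrite adj_sym; apply: (gap_adj (d := W.+1)).
  by rewrite /gap eqxx !orbT.
by rewrite !box_vertexE ?(ltnW xm) ?(ltnW zm) //; lia.
Qed.

Variable col : G -> nat.
Hypothesis col3 : forall v, col v < 3.
Let F x y z := col (box_vertex x y z).

Lemma flat_x_plane x y z : x < m -> y.+1 < m -> z.+1 < m ->
  ~~ [exists w, rainbow_at col x_coord x w] ->
  flat (F x y z) (F x y z.+1) (F x y.+1 z) (F x y.+1 z.+1).
Proof.
move=> xm ym zm none; have [ym' zm'] := (ltnW ym, ltnW zm).
by apply: flat_diagonal; rewrite ?col3 //; apply: not_rainbow none _ _ _ _ _ _;
  rewrite ?x_coord_box ?box_adj_y ?box_adj_z ?box_adj_yz.
Qed.

Lemma flat_y_plane x y z : x.+1 < m -> y < m -> z.+1 < m ->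
  ~~ [exists w, rainbow_at col y_coord y w] ->
  flat (F x y z) (F x.+1 y z) (F x y z.+1) (F x.+1 y z.+1).
Proof.
move=> xm ym zm none; have [xm' zm'] := (ltnW xm, ltnW zm).
by apply: flat_antidiagonal; rewrite ?col3 //; apply: not_rainbow none _ _ _ _ _ _;
  rewrite ?y_coord_box ?box_adj_x ?box_adj_z ?box_adj_xz.
Qed.

Lemma flat_z_plane x y z : x.+1 < m -> y.+1 < m -> z < m ->
  ~~ [exists w, rainbow_at col z_coord z w] ->
  flat (F x y z) (F x.+1 y z) (F x y.+1 z) (F x.+1 y.+1 z).
Proof.
move=> xm ym zm none; have [xm' ym'] := (ltnW xm, ltnW ym).
by apply: flat_antidiagonal; rewrite ?col3 //; apply: not_rainbow none _ _ _ _ _ _;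
  rewrite ?z_coord_box ?box_adj_x ?box_adj_y ?box_adj_xy.
Qed.

(** The box needs only one plane y = b without rainbow triangle, so a thickness of
[K + 1] in direction y is enough. *)
Lemma dominant_box k K L (phi : {ffun edge G -> 'I_k}) :
  stack_layout L phi ->
  (forall u v, col u < col v -> order_rank L u < order_rank L v) ->
  k.+1 ^ 3 <= K -> K < m ->
  exists u : 'I_m * 'I_m, dominant m K (fun x z => F x 0 z) (F u.1 0 u.2).
Proof.
move=> lay mono kK Km.
pose bad coord n : {set 'I_n} := [set i : 'I_n | [exists w, rainbow_at col coord i w]].
have few coord n : #|bad coord n| <= K.
  exact: leq_trans (few_rainbow_planes coord n lay mono) kK.
have /card_gt0P[b] : 0 < #|~: bad y_coord K.+1|.
  by have := cardsC (bad y_coord K.+1); have := few y_coord K.+1; rewrite card_ord; lia.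
rewrite 2!inE => bgood; have bm : b < m by exact: leq_trans (ltn_ord b) Km.
have [||||h lift] := @grid_lift_exists m b F (~: bad x_coord m) (~: bad z_coord m).
- by move=> *; exact: col3.
- by move=> x z xm zm; apply: flat_y_plane.
- move=> x y z; rewrite 2!inE => xgood yb zm; apply: flat_x_plane => //.
  exact: leq_ltn_trans bm.
- move=> x y z; rewrite 2!inE => zgood yb xm; apply: flat_z_plane => //.
  exact: leq_ltn_trans bm.
by apply: dominant_exists lift; rewrite // setCK few.
Qed.

End Box.

(** * Sweeping the two cuts *)

(** The 3-colouring of the positions in a linear order by the three intervals
between the cuts [t] and [c]. *)
Definition cut (t c r : nat) : nat := (t <= r) + (c <= r).

Lemma cut_lt t c r r' : cut t c r < cut t c r' -> r < r'.
Proof. by rewrite /cut; lia. Qed.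

(** Sperner's lemma on the pairs of cuts.  Moving a cut by one position recolours
one vertex, so the colourings at the corners of a cell differ on at most two. *)
Lemma gap_graph_stack s m : let e := 3 * s ^ 3 + 2 in 2 * (e + 2 * e ^ 2) < m ->
  s <= stack_number (gap_graph (2 * m).+1).
Proof.
move=> e em; set G := gap_graph _; rewrite leqNgt; apply/negP.
rewrite /stack_number; case: ex_minnP => k /existsP[L /existsP[phi lay]] _ ks.
have tL : total_order L by have /andP[] := lay.
pose K := s ^ 3; pose M := #|G|.
have kK : k.+1 ^ 3 <= K by rewrite leq_exp2r.
have Km : K < m.
  have : K <= e by rewrite /e /K; lia.
  by move: em; move: (e) => e'; lia.
pose col t c (v : G) := cut t c (order_rank L v).
have col3 t c v : col t c v < 3 by rewrite /col /cut; case: (t <= _); case: (c <= _).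
pose F t c x z := col t c (box_vertex m x 0 z).
pose label_at (p : 'I_M.+1 * 'I_M.+1) (u : 'I_m * 'I_m) :=
  dominant m K (F p.1 p.2) (F p.1 p.2 u.1 u.2).
have [med Hmed] : exists med, forall p, label_at p (med p).
  apply: fin_all_exists => p.
  by apply: (dominant_box (col3 p.1 p.2) lay) => // u v; apply: cut_lt.
pose l t c := let u := med (inord t, inord c) in F t c u.1 u.2.
have lP t c : t <= M -> c <= M -> dominant m K (F t c) (l t c).
  by move=> tM cM; have := Hmed (inord t, inord c); rewrite /label_at /= !inordK.
have l3 t c : l t c < 3 by exact: col3.
have [|||t [c [tc cM H]]] := @sperner_triangle M l l3.
- by move=> c _; rewrite /l /F /col /cut.
- by move=> t _; rewrite /l /F /col /cut [M <= _]leqNgt order_rank_lt addn0; case: (t <= _).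
- by move=> t _; rewrite /l /F /col /cut; case: (t <= _).
pose B := [set u : 'I_m * 'I_m | order_rank L (box_vertex m u.1 0 u.2) == t] :|:
          [set u : 'I_m * 'I_m | order_rank L (box_vertex m u.1 0 u.2) == c].
have m0 : 0 < m by lia.
have one r : #|[set u : 'I_m * 'I_m | order_rank L (box_vertex m u.1 0 u.2) == r]| <= 1.
  apply/card_le1_eqP => -[x z] [x' z']; rewrite !inE /= => /eqP <- /eqP.
  move=> /(order_rank_inj tL) E; congr (_, _); apply: val_inj => /=.
    by rewrite -(x_coord_box (ltn_ord x) m0 (ltn_ord z)) -E x_coord_box.
  by rewrite -(z_coord_box (ltn_ord x) m0 (ltn_ord z)) -E z_coord_box.
have B2 : #|B| <= 2.
  apply: leq_trans (leq_card_setU _ _) _; exact: (leq_add (one t) (one c)).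
have same t' c' : t <= t' <= t.+1 -> c <= c' <= c.+1 ->
    forall u : 'I_m * 'I_m, u \notin B -> F t c u.1 u.2 = F t' c' u.1 u.2.
  move=> tt' cc' u; rewrite !inE /F /col /cut; lia.
have [tM cM'] : t < M /\ c <= M by split; [exact: leq_ltn_trans cM | exact: ltnW].
have D0 := lP t c (ltnW tM) cM'.
case: H => [|[_]]; apply/negP.
  apply: (dominant_not_rainbow em B2 _ _ D0 (lP t c.+1 (ltnW tM) cM) (lP t.+1 c.+1 tM cM)) => //;
  apply: same; lia.
apply: (dominant_not_rainbow em B2 _ _ D0 (lP t.+1 c tM cM') (lP t.+1 c.+1 tM cM)) => //;
apply: same; lia.
Qed.

Theorem theorem1p4 (s : nat) :
  exists G : sgraph, queue_number G <= 3 /\ s <= stack_number G.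
Proof.
pose e := 3 * s ^ 3 + 2; pose m := (2 * (e + 2 * e ^ 2)).+1.
exists (gap_graph (2 * m).+1); split; last exact: gap_graph_stack.
rewrite /queue_number; case: ex_minnP => k _; apply; exact: gap_graph_queue.
Qed.
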